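(* Let $\Gamma_1, \Gamma_2, \Gamma_3, \Gamma_4 \in \mathbb{R}$ be arbitrary circulations (possibly of different signs), with $\Gamma_1+\Gamma_2+\Gamma_3+\Gamma_4 \neq 0$. If the diagonals of a four-vortex convex central configuration $q = (q_1,q_2,q_3,q_4) \in (\mathbb{R}^2)^4$ with these circulations are perpendicular, then the configuration must be a kite.
   Context: Here $q_i \in \mathbb{R}^2$ and $\Gamma_i \in \mathbb{R}$ are the position and circulation of the $i$-th point vortex, $r_{ij} = \|q_i - q_j\|$ is the distance between the $i$-th and $j$-th vortices (positions are pairwise distinct), $M = \sum_{i=1}^4 \Gamma_i$, and $c = \frac{1}{M}\sum_{i=1}^4 \Gamma_i q_i$. The Hamiltonian is $H(q) = -\sum_{i<j} \Gamma_i \Gamma_j \ln(r_{ij})$, and the angular impulse is $I(q) = \sum_{i=1}^4 \Gamma_i \|q_i - c\|^2 = \frac{1}{M}\sum_{i<j} \Gamma_i \Gamma_j r_{ij}^2$. Central configuration: $q=(q_1,\dots,q_4)\in\mathbb{R}^{8}$ is a central configuration of the planar four-vortex problem if it is a critical point of $H$ subject to the constraint $I = I_0$, where $I_0$ is some positive constant. Convex: a configuration of four vortices is convex if no vortex lies inside or on the convex hull of the other three vortices. The four positions are then the vertices of a convex quadrilateral, whose diagonals are the two segments joining opposite vertices. Kite: a configuration of four vortices is a kite if it contains two vortices on an axis of symmetry and the other two vortices are located symmetrically with respect to this axis. (This is a condition on the positions only.)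
   Formalization: At most one of the four circulations is assumed to be zero; with circulations 1, 1, 0, 0 every configuration of distinct points is central, so the statement for arbitrary circulations fails. *)

(* Defs.v *)
From mathcomp Require Import all_boot all_order all_algebra.
From mathcomp Require Import all_classical all_reals all_analysis.

Set Implicit Arguments.
Unset Strict Implicit.
Unset Printing Implicit Defensive.

Import Order.TTheory GRing.Theory Num.Theory.
Import numFieldNormedType.Exports.

Local Open Scope ring_scope.

Section FourVortex.
Variable R : realType.

(* Row i of the matrix is the position q_i in the plane. *)
Definition configuration := 'M[R]_(4, 2).

(* The library norm on row vectors is the sup norm, so the Euclidean structure
   of the plane is introduced by hand. *)
Definition dotp (u v : 'rV[R]_2) : R := \sum_(k < 2) u 0 k * v 0 k.

Definition enorm (u : 'rV[R]_2) : R := Num.sqrt (dotp u u).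

Definition pos (q : configuration) (i : 'I_4) : 'rV[R]_2 := row i q.

Definition dist (q : configuration) (i j : 'I_4) : R :=
  enorm (pos q i - pos q j).

Definition total_circulation (Gam : 'I_4 -> R) : R := \sum_(i < 4) Gam i.

Definition vorticity_center (Gam : 'I_4 -> R) (q : configuration) : 'rV[R]_2 :=
  (total_circulation Gam)^-1 *: \sum_(i < 4) Gam i *: pos q i.

Definition hamiltonian (Gam : 'I_4 -> R) (q : configuration) : R :=
  - \sum_(i < 4) \sum_(j < 4 | (i < j)%N) Gam i * Gam j * ln (dist q i j).

Definition angular_impulse (Gam : 'I_4 -> R) (q : configuration) : R :=
  \sum_(i < 4) Gam i * enorm (pos q i - vorticity_center Gam q) ^+ 2.

(* q is a critical point of the restriction of f to the level set {g = a}: the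
   differential of f vanishes on the tangent space at q of that level set.
   The kernel of 'd g q is this tangent space when 'd g q is nonzero, which for
   g the angular impulse and a > 0 follows from Euler's identity
   'd g q q = 2 * g q. *)
Definition constrained_critical_point
    (f g : configuration -> R) (a : R) (q : configuration) : Prop :=
  g q = a /\ forall v : configuration, 'd g q v = 0 -> 'd f q v = 0.

Definition central_configuration (Gam : 'I_4 -> R) (q : configuration) : Prop :=
  injective (pos q) /\
  exists2 I0 : R, 0 < I0 &
    constrained_critical_point (hamiltonian Gam) (angular_impulse Gam) I0 q.

Definition in_hull_of_others (q : configuration) (i : 'I_4) : Prop :=
  exists w : 'I_4 -> R,
    [/\ forall j, 0 <= w j, w i = 0, \sum_(j < 4) w j = 1
      & pos q i = \sum_(j < 4) w j *: pos q j].

Definition convex_configuration (q : configuration) : Prop :=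
  forall i : 'I_4, ~ in_hull_of_others q i.

(* Twice the signed area of the triangle a b c, positive when a, b, c are in
   counterclockwise order. *)
Definition orient (a b c : 'rV[R]_2) : R :=
  (b - a) 0 0 * (c - a) 0 1 - (b - a) 0 1 * (c - a) 0 0.

(* a, b, c, d are the successive vertices of a convex quadrilateral, traversed
   counterclockwise: there is a left turn at each vertex. The opposite vertices
   are then a, c and b, d. *)
Definition ccw_quadrilateral (a b c d : 'rV[R]_2) : Prop :=
  [/\ 0 < orient a b c, 0 < orient b c d, 0 < orient c d a & 0 < orient d a b].

(* The labels of the vortices need not follow the boundary of the
   quadrilateral. *)
Definition perpendicular_diagonals (q : configuration) : Prop :=
  exists i j k l : 'I_4,
    ccw_quadrilateral (pos q i) (pos q j) (pos q k) (pos q l) /\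
    dotp (pos q k - pos q i) (pos q l - pos q j) = 0.

(* The axis is given by a point p on it and a nonzero normal vector n. *)
Definition on_axis (p n x : 'rV[R]_2) : Prop := dotp (x - p) n = 0.

Definition reflection (p n x : 'rV[R]_2) : 'rV[R]_2 :=
  x - (2 * dotp (x - p) n / dotp n n) *: n.

Definition kite (q : configuration) : Prop :=
  exists i j k l : 'I_4, uniq [:: i; j; k; l] /\
    exists p n : 'rV[R]_2,
      [/\ n != 0, on_axis p n (pos q i), on_axis p n (pos q j)
        & pos q l = reflection p n (pos q k)].

End FourVortex.

(* Main.v *)
(* Eliminating the multiplier from the critical point equations (Dziobek) gives
   S_ij S_kl = S_il S_jk = S_ik S_jl with S_mn = r_mn^-2 - lam. As
   S_ij S_kl = (1 - lam (r_ij^2 + r_kl^2)) / (r_ij r_kl)^2 + lam^2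
   and perpendicularity of the diagonals ik, jl means
   r_ij^2 + r_kl^2 = r_il^2 + r_jk^2 =: s, the first equality forces either
   lam s = 1 or r_ij r_kl = r_il r_jk. In the latter case two adjacent sides are
   equal and the configuration is a kite; in the former the second equality
   yields r_ik^2 + r_jl^2 = s, whereas r_ik^2 + r_jl^2 > s in a convex
   quadrilateral with perpendicular diagonals. *)
From HB Require Import structures.
Require Import Defs.
From mathcomp Require Import all_boot all_order all_algebra.
From mathcomp Require Import all_classical all_reals all_analysis.
From mathcomp Require Import ring lra.

Set Implicit Arguments.
Unset Strict Implicit.
Unset Printing Implicit Defensive.

Import Order.TTheory GRing.Theory Num.Theory.
Import numFieldNormedType.Exports.
Local Open Scope ring_scope.

(** * Differentials of sums, squares, logarithms and matrix entries *)

Section Differentials.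
Context {R : realType} {V : normedModType R}.

Lemma is_diff_sum (I : Type) (r : seq I) (P : pred I) (f df : I -> V -> R) (x : V) :
  (forall i, P i -> is_diff x (f i) (df i)) ->
  is_diff x (fun y => \sum_(i <- r | P i) f i y)
            (fun v => \sum_(i <- r | P i) df i v).
Proof.
move=> dF; elim: r => [|i r IHr].
  under eq_fun do rewrite big_nil.
  under [X in is_diff_def _ _ X]eq_fun do rewrite big_nil.
  exact: is_diff_cst.
under eq_fun do rewrite big_cons.
under [X in is_diff_def _ _ X]eq_fun do rewrite big_cons.
case Pi: (P i) => //; have dfi := dF i Pi.
exact: (is_diffD (f := f i)).
Qed.

Lemma is_diff_mulrl (k : R) (f df : V -> R) (x : V) :
  is_diff x f df -> is_diff x (fun y => k * f y) (fun v => k * df v).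
Proof.
move=> dfx; rewrite (_ : (fun y => _) = k *: f); last exact/funext.
exact: is_diff_eq.
Qed.

Lemma is_diff_sqr (f df : V -> R) (x : V) :
  is_diff x f df -> is_diff x (fun y => f y ^+ 2) (fun v => 2 * f x * df v).
Proof.
move=> dfx; rewrite (_ : (fun y => _) = f ^+ 2); last first.
  by apply/funext => y; rewrite !expr2.
by apply: is_diff_eq; apply/funext => v; rewrite /= expr1.
Qed.

Lemma is_diff_ln (f df : V -> R) (x : V) : 0 < f x ->
  is_diff x f df -> is_diff x (fun y => ln (f y)) (fun v => df v / f x).
Proof.
move=> fx0 dfx.
have dln : is_diff (f x) (@ln R) (fun h => h / f x).
  have [lnd lnE] := is_derive1_ln fx0.
  have lnd' : differentiable (@ln R) (f x) by apply/derivable1_diffP.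
  by apply: DiffDef => //; apply/funext => h; rewrite diff1E // derive1E lnE.
exact: (is_diff_comp (f := f) (g := @ln R)).
Qed.

End Differentials.

Lemma is_diff_coord {R : realType} {m n} (M : 'M[R]_(m.+1, n.+1)) i j :
  is_diff M (fun N : 'M[R]_(m.+1, n.+1) => N i j) (fun N => N i j).
Proof.
pose f := (fun N : 'M[R]_(m.+1, n.+1) => N i j).
have lf : linear f by move=> a A B; rewrite /f !mxE.
pose fM := GRing.isLinear.Build _ _ _ _ _ lf.
pose fL : {linear _ -> _} := HB.pack f fM.
have cf : continuous fL by exact: coord_continuous.
apply: DiffDef; first exact: (@linear_differentiable _ _ _ fL).
exact: (@diff_lin _ _ _ fL).
Qed.

(** * Critical point equations, with one multiplier for all vortices *)

Section CentralEquations.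
Context {R : realType}.
Implicit Types (q v : configuration R) (Gam : 'I_4 -> R).

Lemma dotpE (u v : 'rV[R]_2) : dotp u v = u 0 0 * v 0 0 + u 0 1 * v 0 1.
Proof.
rewrite /dotp !big_ord_recl big_ord0 addr0.
by congr (_ + u 0 _ * v 0 _); apply/val_inj.
Qed.

Lemma dotp_ge0 (u : 'rV[R]_2) : 0 <= dotp u u.
Proof. by rewrite dotpE -!expr2 addr_ge0 ?sqr_ge0. Qed.

Lemma enorm_sqr (u : 'rV[R]_2) : enorm u ^+ 2 = dotp u u.
Proof. by rewrite /enorm sqr_sqrtr ?dotp_ge0. Qed.

(** Polynomial in the entries of [q], hence differentiable everywhere, unlike [dist]. *)
Definition sqdist q i j : R := \sum_(k < 2) (q i k - q j k) ^+ 2.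

Lemma dotp_pos q i j : dotp (pos q i - pos q j) (pos q i - pos q j) = sqdist q i j.
Proof. by apply: eq_bigr => k _; rewrite !mxE expr2. Qed.

Lemma sqdist_gt0 q i j : injective (pos q) -> i != j -> 0 < sqdist q i j.
Proof.
move=> qI; rewrite lt_def; rewrite sumr_ge0 ?andbT; last by move=> k _; exact: sqr_ge0.
apply: contra_neq => /eqP; rewrite psumr_eq0; last by move=> k _; exact: sqr_ge0.
move=> /allP e; apply: qI; apply/rowP => k; rewrite !mxE; apply/eqP.
by have := e k (mem_index_enum k); rewrite /= sqrf_eq0 subr_eq0.
Qed.

Lemma sqdistC q i j : sqdist q i j = sqdist q j i.
Proof. by apply: eq_bigr => k _; rewrite -sqrrN opprB. Qed.

(* Holds for all [x], as [Num.sqrt x] and [ln x] are both 0 when [x <= 0]. *)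
Lemma ln_sqrt (x : R) : ln (Num.sqrt x) = ln x / 2.
Proof.
case: (ltP 0 x) => x0; last by rewrite ler0_sqrtr // !ln0 // mul0r.
rewrite -[in RHS](sqr_sqrtr (ltW x0)) lnXn ?sqrtr_gt0 // -[X in X / _]mulr_natr.
by rewrite mulfK.
Qed.

(** Passing from unordered to ordered pairs makes the differential of the Hamiltonian a full double
    sum, to which [sum_antisym_delta] applies. *)
Lemma sum_sym_lt n (F : 'I_n -> 'I_n -> R) : (forall i j, F i j = F j i) ->
  (forall i, F i i = 0) ->
  \sum_(i < n) \sum_(j < n | (i < j)%N) F i j = (\sum_(i < n) \sum_(j < n) F i j) / 2.
Proof.
move=> Fs F0; apply: (canRL (mulfK _)) => //.
have E : \sum_(i < n) \sum_(j < n | (j < i)%N) F i j =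
         \sum_(i < n) \sum_(j < n | (i < j)%N) F i j.
  by rewrite (exchange_big_dep xpredT) //=; do 2![apply: eq_bigr => ? _].
rewrite mulr_natr mulr2n -{2}E -big_split /=; apply: eq_bigr => i _.
rewrite [RHS](bigID (fun j : 'I_n => (i < j)%N)) /=; congr (_ + _).
rewrite [RHS](bigD1 i) ?ltnn //= F0 add0r; apply: eq_bigl => j.
by rewrite -leqNgt ltn_neqAle andbC.
Qed.

Lemma is_diff_sqdist q i j : is_diff q (fun y => sqdist y i j)
  (fun v => 2 * \sum_(k < 2) (q i k - q j k) * (v i k - v j k)).
Proof.
apply: is_diff_eq.
  apply: is_diff_sum => k _; apply: is_diff_sqr.
  have d1 := is_diff_coord q i k; have d2 := is_diff_coord q j k.
  exact: (is_diffB (f := fun y : configuration R => y i k)).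
by apply/funext => v /=; rewrite mulr_sumr; apply: eq_bigr => k _; rewrite mulrA.
Qed.

Lemma hamiltonianE Gam q : hamiltonian Gam q =
  - 2^-1 * \sum_(i < 4) \sum_(j < 4 | (i < j)%N) Gam i * Gam j * ln (sqdist q i j).
Proof.
rewrite /hamiltonian mulNr mulr_sumr; congr (- _); apply: eq_bigr => i _.
rewrite mulr_sumr; apply: eq_bigr => j _.
by rewrite /dist /enorm ln_sqrt dotp_pos; ring.
Qed.

Lemma is_diff_hamiltonian Gam q : injective (pos q) ->
  is_diff q (hamiltonian Gam) (fun v => - 2^-1 * \sum_(i < 4) \sum_(j < 4)
    Gam i * Gam j * ((\sum_(k < 2) (q i k - q j k) * (v i k - v j k)) / sqdist q i j)).
Proof.
move=> qI; rewrite (funext (hamiltonianE Gam)).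
apply: is_diff_eq.
  apply: is_diff_mulrl; apply: is_diff_sum => i _; apply: is_diff_sum => j ij.
  apply: is_diff_mulrl; apply: is_diff_ln (is_diff_sqdist q i j).
  by apply: sqdist_gt0 => //; rewrite -val_eqE /= neq_ltn ij.
apply/funext => v /=; rewrite sum_sym_lt.
- rewrite mulr_suml; congr (_ * _); apply: eq_bigr => i _.
  rewrite mulr_suml; apply: eq_bigr => j _.
  by set D := (sqdist _ _ _)^-1; field.
- move=> i j; rewrite [sqdist q j i]sqdistC [Gam j * _]mulrC.
  by congr (_ * (2 * _ / _)); apply: eq_bigr => k _; ring.
- by move=> i; rewrite big1 ?(mulr0, mul0r) // => k _; rewrite subrr mul0r.
Qed.

(** Moving only vortex [a] keeps row [a] and column [a] of [W], and by antisymmetry both contribute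
    the same amount. *)
Lemma sum_antisym_delta n (W : 'I_n -> 'I_n -> R) (a : 'I_n) :
  (forall i j, W j i = - W i j) ->
  \sum_(i < n) \sum_(j < n) W i j * ((i == a)%:R - (j == a)%:R) =
  2 * \sum_(j < n) W a j.
Proof.
move=> Wa.
have E : \sum_(i < n) \sum_(j < n) W i j * (i == a)%:R = \sum_(j < n) W a j.
  rewrite (bigD1 a) //= [X in _ + X]big1 ?addr0 => [|i /negPf ia].
    by apply: eq_bigr => j _; rewrite eqxx mulr1.
  by apply: big1 => j _; rewrite ia mulr0.
have E' : \sum_(i < n) \sum_(j < n) W i j * (j == a)%:R = - \sum_(j < n) W a j.
  rewrite exchange_big /= -E -sumrN; apply: eq_bigr => i _.
  by rewrite -sumrN; apply: eq_bigr => j _; rewrite Wa mulNr.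
under eq_bigr do under eq_bigr do rewrite mulrBr.
under eq_bigr do rewrite sumrB.
by rewrite sumrB E E'; ring.
Qed.

Lemma diff_hamiltonian_delta Gam q a b : injective (pos q) ->
  'd (hamiltonian Gam) q (delta_mx a b) =
  - (Gam a * \sum_(j < 4) Gam j * ((q a b - q j b) / sqdist q a j)).
Proof.
move=> qI; have dH := is_diff_hamiltonian Gam qI; rewrite diff_val.
pose W i j := Gam i * Gam j * ((q i b - q j b) / sqdist q i j).
transitivity (- 2^-1 * \sum_(i < 4) \sum_(j < 4) W i j * ((i == a)%:R - (j == a)%:R)).
  congr (_ * _); apply: eq_bigr => i _; apply: eq_bigr => j _.
  rewrite (bigD1 b) //= [X in _ + X]big1 ?addr0 => [|k /negPf kb]; last first.
    by rewrite !mxE kb !andbF subrr mulr0.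
  by rewrite !mxE eqxx !andbT /W; ring.
rewrite sum_antisym_delta => [|i j]; last by rewrite /W sqdistC; ring.
rewrite mulrA mulNr mulVf // mulN1r mulr_sumr; congr (- _).
by apply: eq_bigr => j _; rewrite /W -mulrA.
Qed.

Definition centered Gam q i k : R :=
  q i k - (total_circulation Gam)^-1 * \sum_(j < 4) Gam j * q j k.

Lemma angular_impulseE Gam q : angular_impulse Gam q =
  \sum_(i < 4) Gam i * \sum_(k < 2) centered Gam q i k ^+ 2.
Proof.
apply: eq_bigr => i _; rewrite enorm_sqr; congr (_ * _); apply: eq_bigr => k _.
rewrite /vorticity_center /centered !mxE summxE expr2; under eq_bigr do rewrite !mxE.
by [].
Qed.

Lemma is_diff_angular_impulse Gam q :
  is_diff q (angular_impulse Gam) (fun v => 2 * \sum_(i < 4)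
    Gam i * \sum_(k < 2) centered Gam q i k * centered Gam v i k).
Proof.
rewrite (funext (angular_impulseE Gam)).
apply: is_diff_eq.
  apply: is_diff_sum => i _; apply: is_diff_mulrl; apply: is_diff_sum => k _.
  apply: is_diff_sqr; rewrite /centered.
  have d1 := is_diff_coord q i k.
  apply: (is_diffB (f := fun y : configuration R => y i k)).
  apply: is_diff_mulrl; apply: is_diff_sum => j _; apply: is_diff_mulrl.
  exact: is_diff_coord.
apply/funext => v /=; rewrite mulr_sumr; apply: eq_bigr => i _.
rewrite mulrCA; congr (_ * _); rewrite mulr_sumr; apply: eq_bigr => k _.
by rewrite mulrA.
Qed.

(** Euler's identity: [centered] is linear in the configuration, so the angular impulse is a
    quadratic form. *)
Lemma diff_angular_impulse_self Gam q :
  'd (angular_impulse Gam) q q = 2 * angular_impulse Gam q.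
Proof.
have dI := is_diff_angular_impulse Gam q; rewrite diff_val angular_impulseE.
by congr (_ * _); apply: eq_bigr => i _; congr (_ * _); apply: eq_bigr => k _.
Qed.

Lemma sum_centered Gam q k : total_circulation Gam != 0 ->
  \sum_(i < 4) Gam i * centered Gam q i k = 0.
Proof.
move=> M0; under eq_bigr do rewrite mulrBr.
by rewrite sumrB -mulr_suml mulrA mulfV // mul1r subrr.
Qed.

Lemma diff_angular_impulse_delta Gam q a b : total_circulation Gam != 0 ->
  'd (angular_impulse Gam) q (delta_mx a b) =
  2 * (total_circulation Gam)^-1 * (Gam a * \sum_(j < 4) Gam j * (q a b - q j b)).
Proof.
move=> M0; have dI := is_diff_angular_impulse Gam q; rewrite diff_val -mulrA.
congr (_ * _).
(* The motion of the center contributes nothing, because the weighted sum of the centered positions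
   vanishes. *)
transitivity (\sum_(i < 4) Gam i *
    \sum_(k < 2) centered Gam q i k * (delta_mx a b : configuration R) i k).
  apply/eqP; rewrite -subr_eq0 -sumrB; apply/eqP.
  under eq_bigr do rewrite -mulrBr -sumrB mulr_sumr.
  rewrite exchange_big big1 //= => k _.
  under eq_bigr => i _ do rewrite -mulrBr {2}/centered addrAC subrr add0r mulrA.
  by rewrite -mulr_suml sum_centered // mul0r.
rewrite (bigD1 a) //= [X in _ + X]big1 ?addr0 => [|i /negPf ia]; last first.
  by rewrite big1 ?mulr0 // => k _; rewrite mxE ia mulr0.
rewrite mulrCA; congr (_ * _).
rewrite (bigD1 b) //= [X in _ + X]big1 ?addr0 => [|k /negPf kb]; last first.
  by rewrite mxE kb andbF mulr0.
rewrite mxE !eqxx mulr1 /centered.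
under [in RHS]eq_bigr do rewrite mulrBr.
by rewrite sumrB -mulr_suml mulrBr mulrA mulVf // mul1r.
Qed.

Lemma central_equations Gam q : total_circulation Gam != 0 ->
  central_configuration Gam q ->
  exists lam : R, forall i k,
    Gam i * \sum_(j < 4) Gam j * ((sqdist q i j)^-1 - lam) * (q i k - q j k) = 0.
Proof.
move=> M0 [qI [I0 I0gt0 [IE crit]]].
set dH := 'd (hamiltonian Gam) q in crit; set dI := 'd (angular_impulse Gam) q in crit.
have dIq : dI q != 0.
  by rewrite diff_angular_impulse_self IE mulf_neq0 // gt_eqF.
(* Since [dI q] is nonzero, [q] spans a complement of the kernel of [dI]. Subtracting a multiple of
   [q] sends any [v] into that kernel, where [dH] vanishes, so [dH] is [mu] times [dI]. *)
pose mu := dH q / dI q.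
have E v : dH v = mu * dI v.
  have dB (f : configuration R -> R) c :
      'd f q (v - c *: q) = 'd f q v - c * 'd f q q by rewrite linearB linearZ.
  have I_eq0 : dI (v - (dI v / dI q) *: q) = 0.
    by apply: etrans (dB _ _) _; rewrite divfK // subrr.
  have /eqP := etrans (esym (dB _ _)) (crit _ I_eq0).
  by rewrite subr_eq0 => /eqP; rewrite mulrAC -mulrA mulrC.
(* The factor [2 / total_circulation Gam] comes from [dI] on elementary matrices, and the sign from
   that of the Hamiltonian. *)
exists (- (2 * mu / total_circulation Gam)) => i k.
have := E (delta_mx i k); rewrite /dH /dI => Eik.
have := diff_hamiltonian_delta Gam i k qI; rewrite Eik.
rewrite diff_angular_impulse_delta // => /eqP; rewrite -subr_eq0 opprK => /eqP Eik0.
apply: etrans Eik0; rewrite !mulr_sumr -big_split /=.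
by apply: eq_bigr => j _; ring.
Qed.

End CentralEquations.

(** * Dziobek's relations from affine dependences *)

Section Dziobek.
Context {R : realType}.

Lemma sum4 (F : 'I_4 -> R) i j k l : uniq [:: i; j; k; l] ->
  \sum_(m < 4) F m = F i + F j + F k + F l.
Proof.
move=> U; rewrite (perm_big [:: i; j; k; l]) /=.
  by rewrite !big_cons big_nil addr0 !addrA.
apply: uniq_perm => //; first exact: index_enum_uniq.
move=> m; rewrite mem_index_enum.
have [||_ ->] := uniq_min_size U (s2 := enum 'I_4); last by rewrite mem_enum.
- by move=> t _; rewrite mem_enum.
- by rewrite size_enum_ord.
Qed.

(** The first two of the three plane vectors are independent, so the linear dependences form a line,
    and [d3 != 0] makes [d] a generator. The proof eliminates the third vector, then applies
    Cramer's rule. *)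
Lemma proportional_coefficients (x1 y1 x2 y2 x3 y3 a1 a2 a3 d1 d2 d3 : R) :
  x1 * y2 - y1 * x2 != 0 -> d3 != 0 ->
  a1 * x1 + a2 * x2 + a3 * x3 = 0 -> a1 * y1 + a2 * y2 + a3 * y3 = 0 ->
  d1 * x1 + d2 * x2 + d3 * x3 = 0 -> d1 * y1 + d2 * y2 + d3 * y3 = 0 ->
  exists s, [/\ a1 = s * d1, a2 = s * d2 & a3 = s * d3].
Proof.
move=> c0 d0 ax ay dx dy; exists (a3 / d3); rewrite divfK //.
have ex : (a1 * d3 - a3 * d1) * x1 + (a2 * d3 - a3 * d2) * x2 = 0.
  transitivity (d3 * (a1 * x1 + a2 * x2 + a3 * x3) - a3 * (d1 * x1 + d2 * x2 + d3 * x3)).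
    by ring.
  by rewrite ax dx !mulr0 subrr.
have ey : (a1 * d3 - a3 * d1) * y1 + (a2 * d3 - a3 * d2) * y2 = 0.
  transitivity (d3 * (a1 * y1 + a2 * y2 + a3 * y3) - a3 * (d1 * y1 + d2 * y2 + d3 * y3)).
    by ring.
  by rewrite ay dy !mulr0 subrr.
move: ex ey; set b1 := a1 * d3 - _; set b2 := a2 * d3 - _ => ex ey.
have /eqP : b1 * (x1 * y2 - y1 * x2) = 0.
  transitivity ((b1 * x1 + b2 * x2) * y2 - (b1 * y1 + b2 * y2) * x2); first by ring.
  by rewrite ex ey !mul0r subrr.
have /eqP : b2 * (x1 * y2 - y1 * x2) = 0.
  transitivity ((b1 * y1 + b2 * y2) * x1 - (b1 * x1 + b2 * x2) * y1); first by ring.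
  by rewrite ex ey !mul0r subrr.
rewrite !mulf_eq0 (negPf c0) !orbF !subr_eq0 => /eqP e2 /eqP e1.
by split=> //; rewrite mulrAC -?e1 -?e2 mulfK.
Qed.

(* Both coefficient vectors are affine dependences of four points in general
   position, hence proportional. *)
Lemma vertex_relation (q : configuration R) (w : 'I_4 -> R) i j k l :
  uniq [:: i; j; k; l] ->
  orient (pos q i) (pos q j) (pos q k) != 0 ->
  (forall c, \sum_(m < 4) w m * (q i c - q m c) = 0) ->
  exists s, [/\ w j = s * orient (pos q k) (pos q l) (pos q i),
                w k = - (s * orient (pos q l) (pos q i) (pos q j)) &
                w l = s * orient (pos q i) (pos q j) (pos q k)].
Proof.
move=> U o0 e.
have := e 0; have := e 1; rewrite !(sum4 _ U) !subrr !mulr0 !add0r => ey ex.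
have [|||s [h1 h2 h3]] := @proportional_coefficients
  (q i 0 - q j 0) (q i 1 - q j 1) (q i 0 - q k 0) (q i 1 - q k 1)
  (q i 0 - q l 0) (q i 1 - q l 1) (w j) (w k) (w l)
  (orient (pos q k) (pos q l) (pos q i))
  (- orient (pos q l) (pos q i) (pos q j))
  (orient (pos q i) (pos q j) (pos q k)) _ o0 ex ey.
- by apply: contra o0 => /eqP h; rewrite /orient !mxE -h; apply/eqP; ring.
- by rewrite /orient !mxE; ring.
- by rewrite /orient !mxE; ring.
by exists s; rewrite -mulrN.
Qed.

(** If all circulations are nonzero, [S m n] is a factor of [m] times [dn / Gam n], and the products
    agree by symmetry of [S]. If one circulation vanishes, the relation at every other vertex has
    [s = 0], so [S] vanishes between the three other vertices; each product has a factor of that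
    kind, so all are 0. *)
Lemma dziobek_relations (Gam : 'I_4 -> R) (S : 'I_4 -> 'I_4 -> R) i j k l
    (di dj dk dl : R) :
  (forall m n, Gam m = 0 -> Gam n = 0 -> m = n) ->
  uniq [:: i; j; k; l] -> (forall m n, S m n = S n m) ->
  di != 0 -> dj != 0 -> dk != 0 -> dl != 0 ->
  (Gam i != 0 -> exists s, [/\ Gam j * S i j = s * dj, Gam k * S i k = s * dk &
                               Gam l * S i l = s * dl]) ->
  (Gam j != 0 -> exists s, [/\ Gam k * S j k = s * dk, Gam l * S j l = s * dl &
                               Gam i * S j i = s * di]) ->
  (Gam k != 0 -> exists s, [/\ Gam l * S k l = s * dl, Gam i * S k i = s * di &
                               Gam j * S k j = s * dj]) ->
  (Gam l != 0 -> exists s, [/\ Gam i * S l i = s * di, Gam j * S l j = s * dj &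
                               Gam k * S l k = s * dk]) ->
  S i j * S k l = S i l * S j k /\ S i j * S k l = S i k * S j l.
Proof.
move=> hG U Ssym di0 dj0 dk0 dl0.
have hG' m n : m != n -> Gam m = 0 -> Gam n != 0.
  by move=> mn m0; apply: contra_neq mn => n0; exact: hG.
have s0 (g s d t : R) : g = 0 -> d != 0 -> g * t = s * d -> s = 0.
  by move=> -> d0; rewrite mul0r => /esym/eqP; rewrite mulf_eq0 (negPf d0) orbF => /eqP.
have t0 (g s d t : R) : g != 0 -> s = 0 -> g * t = s * d -> t = 0.
  by move=> g0 ->; rewrite mul0r => /eqP; rewrite mulf_eq0 (negPf g0) => /eqP.
have t1 (g s d t : R) : g != 0 -> g * t = s * d -> t = s * d / g.
  by move=> g0 <-; rewrite mulrAC mulfV ?mul1r.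
move: U; rewrite /= !inE !negb_or -!andbA => /and5P[ij ik il jk /and3P[jl kl _]].
rewrite ![S j i]Ssym ![S k i]Ssym ![S l i]Ssym ![S k j]Ssym ![S l j]Ssym ![S l k]Ssym.
move=> Hi Hj Hk Hl.
have [i0|i0] := eqVneq (Gam i) 0.
  have [gj gk gl] := And3 (hG' _ _ ij i0) (hG' _ _ ik i0) (hG' _ _ il i0).
  have [s [a b c]] := Hj gj; have [s' [a' b' c']] := Hk gk.
  have sE := s0 _ _ _ _ i0 di0 c; have s'E := s0 _ _ _ _ i0 di0 b'.
  by rewrite (t0 _ _ _ _ gk sE a) (t0 _ _ _ _ gl sE b) (t0 _ _ _ _ gl s'E a') !mulr0.
have [j0|j0] := eqVneq (Gam j) 0.
  have [gk gl] := conj (hG' _ _ jk j0) (hG' _ _ jl j0).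
  have [s [a b c]] := Hi i0; have [s' [a' b' c']] := Hk gk.
  have sE := s0 _ _ _ _ j0 dj0 a; have s'E := s0 _ _ _ _ j0 dj0 c'.
  by rewrite (t0 _ _ _ _ gk sE b) (t0 _ _ _ _ gl sE c) (t0 _ _ _ _ gl s'E a') !(mulr0, mul0r).
have [k0|k0] := eqVneq (Gam k) 0.
  have gl := hG' _ _ kl k0.
  have [s [a b c]] := Hi i0; have [s' [a' b' c']] := Hj j0.
  have sE := s0 _ _ _ _ k0 dk0 b; have s'E := s0 _ _ _ _ k0 dk0 a'.
  by rewrite (t0 _ _ _ _ j0 sE a) (t0 _ _ _ _ gl sE c) (t0 _ _ _ _ gl s'E b') !(mulr0, mul0r).
have [l0|l0] := eqVneq (Gam l) 0.
  have [s [a b c]] := Hi i0; have [s' [a' b' c']] := Hj j0.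
  have sE := s0 _ _ _ _ l0 dl0 c; have s'E := s0 _ _ _ _ l0 dl0 b'.
  by rewrite (t0 _ _ _ _ j0 sE a) (t0 _ _ _ _ k0 sE b) (t0 _ _ _ _ k0 s'E a') !(mulr0, mul0r).
(* The first equality uses the relations at [i] and [k], the second those at [i] and [l]. *)
have [si [a b c]] := Hi i0; have [sk [a' b' c']] := Hk k0.
have [sl [a'' b'' c'']] := Hl l0.
split.
  rewrite (t1 _ _ _ _ j0 a) (t1 _ _ _ _ l0 a') (t1 _ _ _ _ l0 c) (t1 _ _ _ _ j0 c').
  by ring.
rewrite (t1 _ _ _ _ j0 a) (t1 _ _ _ _ k0 c'') (t1 _ _ _ _ k0 b) (t1 _ _ _ _ j0 b'').
by ring.
Qed.

Lemma central_dziobek (Gam : 'I_4 -> R) (q : configuration R) i j k l :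
  (forall m n, Gam m = 0 -> Gam n = 0 -> m = n) -> total_circulation Gam != 0 ->
  central_configuration Gam q -> uniq [:: i; j; k; l] ->
  ccw_quadrilateral (pos q i) (pos q j) (pos q k) (pos q l) ->
  exists lam, let S m n := (sqdist q m n)^-1 - lam in
    S i j * S k l = S i l * S j k /\ S i j * S k l = S i k * S j l.
Proof.
move=> hG M0 cq U [/lt0r_neq0 oijk /lt0r_neq0 ojkl /lt0r_neq0 okli /lt0r_neq0 olij].
have [lam e] := central_equations M0 cq; exists lam => S.
have {}e m : Gam m != 0 -> forall c, \sum_(n < 4) (Gam n * S m n) * (q m c - q n c) = 0.
  by move=> m0 c; apply/eqP; have /eqP := e m c; rewrite mulf_eq0 (negPf m0).
have Uj : uniq [:: j; k; l; i] by rewrite -(rot_uniq 1) in U.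
have Uk : uniq [:: k; l; i; j] by rewrite -(rot_uniq 1) in Uj.
have Ul : uniq [:: l; i; j; k] by rewrite -(rot_uniq 1) in Uk.
(* The alternating signed areas are the coefficients of the affine dependence of the four vertices.
   [vertex_relation] fixes the sign relative to its first vertex, hence the factor [- s] at [i] and
   [k]. *)
apply: (dziobek_relations (Gam := Gam) (di := orient (pos q j) (pos q k) (pos q l))
  (dj := - orient (pos q k) (pos q l) (pos q i))
  (dk := orient (pos q l) (pos q i) (pos q j))
  (dl := - orient (pos q i) (pos q j) (pos q k))); rewrite ?oppr_eq0 //.
- by move=> m n; rewrite /S sqdistC.
- move=> /e /(vertex_relation U oijk)[s [-> -> ->]]; exists (- s).
  by split; rewrite ?mulrN ?mulNr ?opprK.
- move=> /e /(vertex_relation Uj ojkl)[s [-> -> ->]]; exists s.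
  by split; rewrite ?mulrN ?mulNr ?opprK.
- move=> /e /(vertex_relation Uk okli)[s [-> -> ->]]; exists (- s).
  by split; rewrite ?mulrN ?mulNr ?opprK.
- move=> /e /(vertex_relation Ul olij)[s [-> -> ->]]; exists s.
  by split; rewrite ?mulrN ?mulNr ?opprK.
Qed.

End Dziobek.

(** * Plane geometry of perpendicular diagonals *)

Section PerpendicularDiagonals.
Context {R : realType}.
Implicit Types a b c d : 'rV[R]_2.

Definition vsqdist a b : R := dotp (a - b) (a - b).

Lemma vsqdistC a b : vsqdist a b = vsqdist b a.
Proof. by rewrite /vsqdist !dotpE !mxE; ring. Qed.

Lemma perp_opposite_sides a b c d : dotp (c - a) (d - b) = 0 ->
  vsqdist a b + vsqdist c d = vsqdist a d + vsqdist b c.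
Proof.
move=> h; apply/eqP; rewrite -subr_eq0; apply/eqP.
transitivity (- 2 * dotp (c - a) (d - b)); last by rewrite h mulr0.
by rewrite /vsqdist !dotpE !mxE; ring.
Qed.

(** If the crossing point cuts the diagonals into lengths [p], [r] and [s], [t], the difference is
    [(p + r)^2 + (s + t)^2 - (p^2 + s^2 + r^2 + t^2) = 2 p r + 2 s t]. Each [orient] is a diagonal
    length times one of these four lengths, which gives a polynomial identity free of the crossing
    point. *)
Lemma diagonals_gt_sides a b c d : 0 < vsqdist a c -> 0 < vsqdist b d ->
  ccw_quadrilateral a b c d -> dotp (c - a) (d - b) = 0 ->
  vsqdist a b + vsqdist c d < vsqdist a c + vsqdist b d.
Proof.
move=> ac0 bd0 [oabc obcd ocda odab] h; rewrite -subr_gt0.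
rewrite -(pmulr_lgt0 _ (mulr_gt0 ac0 bd0)).
pose al := dotp (c - a) (b - a); pose be := dotp (d - b) (b - a).
(* The cofactor K comes from the vanishing of the Gram determinant of the plane
   vectors c - a, d - b, b - a. *)
pose K := vsqdist a c * vsqdist b d - al * vsqdist b d + be * vsqdist a c -
  2 * al * be + vsqdist a b * dotp (c - a) (d - b).
suff -> : (vsqdist a c + vsqdist b d - (vsqdist a b + vsqdist c d)) *
    (vsqdist a c * vsqdist b d) =
  2 * (orient b c d * orient d a b * vsqdist a c +
       orient a b c * orient c d a * vsqdist b d) + 2 * dotp (c - a) (d - b) * K.
  by rewrite h mulr0 mul0r addr0 mulr_gt0 ?addr_gt0 ?mulr_gt0.
by rewrite /K /al /be /vsqdist /orient !dotpE !mxE; ring.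
Qed.

Lemma dziobek_term (x y lam : R) : x != 0 -> y != 0 ->
  (x^-1 - lam) * (y^-1 - lam) = (1 - lam * (x + y)) / (x * y) + lam ^+ 2.
Proof. by move=> x0 y0; field; rewrite x0 y0. Qed.

Lemma adjacent_sides_eq a b c d (lam : R) :
  0 < vsqdist a b -> 0 < vsqdist c d -> 0 < vsqdist a d ->
  0 < vsqdist b c -> 0 < vsqdist a c -> 0 < vsqdist b d ->
  ccw_quadrilateral a b c d -> dotp (c - a) (d - b) = 0 ->
  let S x y := (vsqdist x y)^-1 - lam in
  S a b * S c d = S a d * S b c -> S a b * S c d = S a c * S b d ->
  vsqdist a b = vsqdist a d \/ vsqdist a b = vsqdist b c.
Proof.
move=> ab0 cd0 ad0 bc0 ac0 bd0 ccw h S; rewrite /S.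
have lt := diagonals_gt_sides ac0 bd0 ccw h; have sum := perp_opposite_sides h.
move: lt sum ab0 cd0 ad0 bc0 ac0 bd0; move: (vsqdist a b) (vsqdist c d) (vsqdist a d)
  (vsqdist b c) (vsqdist a c) (vsqdist b d) => A B C D E F lt sum.
move=> /lt0r_neq0 A0 /lt0r_neq0 B0 /lt0r_neq0 C0 /lt0r_neq0 D0 /lt0r_neq0 E0 /lt0r_neq0 F0.
rewrite !dziobek_term //.
move=> /addIr; rewrite -sum => e1 /addIr e2.
have [s1|s1] := eqVneq (1 - lam * (A + B)) 0; last first.
  have AB : A * B = C * D by apply: invr_inj; exact: mulfI e1.
  (* The pairs [A, B] and [C, D] have the same sum and product, so [A] is a root of
     [(x - C) * (x - D)]. *)
  have /eqP : (A - C) * (A - D) = 0.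
    transitivity (A * (A + B) - A * (C + D) + (C * D - A * B)); first by ring.
    by rewrite sum AB !subrr addr0.
  by rewrite mulf_eq0 !subr_eq0 => /orP[] /eqP ->; [left|right].
move: e2; rewrite s1 mul0r => /esym/eqP; rewrite mulf_eq0 invr_eq0 mulf_eq0.
rewrite (negPf E0) (negPf F0) !orbF -s1 => /eqP e2; exfalso.
have l0 : lam != 0.
  by apply: contra_eq_neq s1 => ->; rewrite mul0r subr0 oner_neq0.
have /(mulfI l0) e3 : lam * (E + F) = lam * (A + B) by lra.
by rewrite e3 ltxx in lt.
Qed.

(** The axis is the diagonal through [i] and [k], with normal [pos q l - pos q j]. Equidistance puts
    [i] on the perpendicular bisector of the other diagonal, so the reflection swaps [j] and [l]. *)
Lemma kite_of_equidistant (q : configuration R) i j k l : uniq [:: i; j; k; l] ->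
  0 < vsqdist (pos q j) (pos q l) ->
  dotp (pos q k - pos q i) (pos q l - pos q j) = 0 ->
  vsqdist (pos q i) (pos q j) = vsqdist (pos q i) (pos q l) -> kite q.
Proof.
move=> U jl h e; exists i, k, j, l; split.
  by rewrite -(perm_uniq (s1 := [:: i; j; k; l])) // perm_cons (perm_catCA [:: j] [:: k]).
exists (pos q i), (pos q l - pos q j); split.
- by apply: contraTneq jl => e0; rewrite vsqdistC /vsqdist e0 dotpE !mxE !mul0r addr0 ltxx.
- by rewrite /on_axis dotpE !mxE !subrr !mul0r addr0.
- by [].
have E : 2 * dotp (pos q j - pos q i) (pos q l - pos q j) =
  - vsqdist (pos q l) (pos q j).
  apply/eqP; rewrite -subr_eq0; apply/eqP.
  transitivity (vsqdist (pos q i) (pos q l) - vsqdist (pos q i) (pos q j)).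
    by rewrite /vsqdist !dotpE !mxE; ring.
  by rewrite e subrr.
rewrite /reflection E mulNr mulfV; last by rewrite vsqdistC lt0r_neq0.
by rewrite scaleN1r opprK addrC subrK.
Qed.

End PerpendicularDiagonals.

(* At most one circulation vanishes: with circulations 1, 1, 0, 0 every
   configuration of distinct points is central, so the last two vortices can be
   placed to make a convex quadrilateral with perpendicular diagonals that is not
   a kite. *)
Theorem theorem4p1 (R : realType) (Gam : 'I_4 -> R) (q : configuration R)
  (hGam : forall i j : 'I_4, Gam i = 0 -> Gam j = 0 -> i = j)
  (hM : \sum_(i < 4) Gam i != 0)
  (hcentral : central_configuration Gam q)
  (hconvex : convex_configuration q)
  (hperp : perpendicular_diagonals q) :
  kite q.
Proof.
have [i [j [k [l [ccw h]]]]] := hperp.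
(* A triangle with a repeated vertex has zero area, so strict left turns force distinct labels. *)
have o2 a b : orient a b b = 0 :> R by rewrite /orient; ring.
have o1 a b : orient a b a = 0 :> R by rewrite /orient !mxE; ring.
have o0 a b : orient a a b = 0 :> R by rewrite /orient !mxE; ring.
have U : uniq [:: i; j; k; l].
  have [oijk ojkl okli _] := ccw.
  rewrite /= !inE !negb_or -!andbA; apply/and5P; split; [..|apply/andP; split].
  - by apply: contraTneq oijk => ->; rewrite o0 ltxx.
  - by apply: contraTneq oijk => ->; rewrite o1 ltxx.
  - by apply: contraTneq okli => ->; rewrite o2 ltxx.
  - by apply: contraTneq oijk => ->; rewrite o2 ltxx.
  - by apply: contraTneq ojkl => ->; rewrite o1 ltxx.
  - by rewrite andbT; apply: contraTneq okli => ->; rewrite o0 ltxx.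
have pos_dist m n : m != n -> 0 < vsqdist (pos q m) (pos q n).
  by move=> mn; rewrite /vsqdist dotp_pos sqdist_gt0 //; case: hcentral.
have [lam [e1 e2]] := central_dziobek hGam hM hcentral U ccw.
have := U; rewrite /= !inE !negb_or -!andbA => /and5P[ij ik il jk /and3P[jl kl _]].
have [] := adjacent_sides_eq (lam := lam) (pos_dist _ _ ij) (pos_dist _ _ kl)
  (pos_dist _ _ il) (pos_dist _ _ jk) (pos_dist _ _ ik) (pos_dist _ _ jl) ccw h.
- by rewrite /vsqdist !dotp_pos.
- by rewrite /vsqdist !dotp_pos.
- exact: kite_of_equidistant (pos_dist _ _ jl) h.
(* Here [j] is equidistant from [i] and [k], so the labels shift cyclically and the axis is the
   diagonal through [j] and [l]; the shift changes the sign of the dot product. *)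
rewrite vsqdistC => /esym; apply: (kite_of_equidistant (k := l)).
- by move: U; rewrite -(rot_uniq 1).
- by rewrite pos_dist // eq_sym.
by apply: oppr_inj; rewrite oppr0; apply: etrans h; rewrite !dotpE !mxE; ring.
Qed.
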